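(* Consider Contaminated Best Arm Identification (CBAI) against an oblivious, prescient, or malicious adversary, with $F_i\in\mathcal{F}_{\bar t,B}$ and $m_2(F_i)\le\bar m_2$ for each arm $i\in[k]$. For $\alpha>0$, $\delta\in(0,1)$ put $$n_{\alpha,\delta}=2\max\left(\tfrac{B^2\bar m_2^2}{\alpha^2},\left(\bar t-\tfrac{\varepsilon}{2(1-\varepsilon)}\right)^{-2}\right)\log\tfrac2\delta$$ for oblivious and prescient adversaries, and $$n_{\alpha,\delta}=2\max\left(\tfrac{B^2\bar m_2^2}{\alpha^2},(\bar t-\varepsilon)^{-2}\right)\log\tfrac3\delta$$ for malicious adversaries. Then, for any $\alpha>0$ and $\delta\in(0,1)$, the algorithm that samples each arm $i\in[k]$ $n_{\alpha/2,\delta/k}$ times (rounded up), lets $\hat p_i$ be the empirical median of the observed samples of arm $i$, and outputs $\hat I\in\arg\max_{i\in[k]}\hat p_i$, is an $(\alpha,\delta)$-PAC CBAI algorithm with sample complexity $O(k\,n_{\alpha/2,\delta/k})=O\left(\frac{k}{\alpha^2}\log\frac k\delta\right)$, where in the last expression the constant may depend on $B,\bar m_2,\bar t,\varepsilon$ and the $\alpha$-independent term in the maximum is regarded as lower order (small $\alpha$).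
   Context: Notation. Distributions are on $\mathbb{R}$ and identified with cdfs. $Q_{L,F}(p)=\inf\{x:F(x)\ge p\}$, $Q_{R,F}(p)=\inf\{x:F(x)>p\}$. $m_1(F)$ is the (unique) median of $F$ and $m_2(F)$ is the median of $|X-m_1(F)|$, $X\sim F$. The empirical median is the middle value for an odd number of samples, and the average of the two middle values otherwise. For $\bar t\in(0,\tfrac12)$, $B>0$, $\mathcal{F}_{\bar t,B}$ is the family of distributions $F$ with a unique median and $|F(x_1)-F(x_2)|\ge\frac{1}{B\,m_2(F)}|x_1-x_2|$ for all $x_1,x_2\in[Q_{L,F}(\tfrac12-\bar t),Q_{R,F}(\tfrac12+\bar t)]$. CBAI. There are $k\ge2$ arms with unknown true distributions $F_1,\dots,F_k$ and a contamination level $\varepsilon\in(0,\tfrac12)$. At each iteration $t$ an algorithm picks an arm $I_t\in[k]$ and observes $X_{I_t,t}$, where $X_{i,t}=(1-D_{i,t})Y_{i,t}+D_{i,t}Z_{i,t}$, $Y_{i,t}\sim F_i$, $D_{i,t}\sim\mathrm{Ber}(\varepsilon)$, and $Z_{i,t}$ is an arbitrary contamination. After $T$ iterations (a possibly random stopping time) it outputs an arm $\hat I$; $T$ is the sample complexity. Adversaries: - Oblivious: for each $i$ the triples $(Y_{i,t},D_{i,t},Z_{i,t})_{t\ge1}$ are independent across $t$; $Y_{i,t}$ and $D_{i,t}$ are independent. - Prescient: for each $i$ the pairs $(Y_{i,t},D_{i,t})_{t\ge1}$ are independent across $t$, $Y_{i,t}$ and $D_{i,t}$ are independent, and each $Z_{i,t}$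 may depend on all of $\{Y_{j,s},D_{j,s},Z_{j,s}\}_{j\in[k],s\ge1}$. - Malicious: as prescient, but $Y_{i,t}$ and $D_{i,t}$ need not be independent of each other. No independence across arms is required for fixed $t$. The parameters satisfy $\tfrac{\varepsilon}{2(1-\varepsilon)}<\bar t<\tfrac12$ (oblivious, prescient) or $\varepsilon<\bar t<\tfrac12$ (malicious), and are known to the algorithm. The unavoidable uncertainty of arm $i$ is $U_i=B\,m_2(F_i)\frac{\varepsilon}{2(1-\varepsilon)}$ for oblivious and prescient adversaries and $U_i=B\,m_2(F_i)\,\varepsilon$ for malicious ones. With $i^*=\arg\max_i m_1(F_i)$, the effective gaps are $\tilde\Delta_i=(m_1(F_{i^*})-U_{i^*})-(m_1(F_i)+U_i)$. An algorithm is $(\alpha,\delta)$-PAC if $\mathbb{P}(\tilde\Delta_{\hat I}\le\alpha)\ge1-\delta$, i.e. $\mathbb{P}\big(m_1(F_{\hat I})\ge\max_im_1(F_i)-(\alpha+U_{i^*}+U_{\hat I})\big)\ge1-\delta$. *)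

(* Defs.v *)
(* MathComp-Analysis. *)
From HB Require Import structures.
From mathcomp Require Import all_boot all_order all_algebra.
From mathcomp Require Import finmap.
From mathcomp Require Import all_classical all_reals all_analysis.

Set Implicit Arguments.
Unset Strict Implicit.
Unset Printing Implicit Defensive.

Import Order.TTheory GRing.Theory Num.Theory.
Import numFieldNormedType.Exports.
Local Open Scope classical_set_scope.
Local Open Scope ring_scope.

Section Distributions.
Context {R : realType}.

Definition cdf_of (F : probability R R) (x : R) : R := fine (F `]-oo, x]%classic).

Definition QL (F : probability R R) (p : R) : R :=
  inf [set x | p <= cdf_of F x].

Definition QR (F : probability R R) (p : R) : R :=
  inf [set x | p < cdf_of F x].

Definition is_median (mu : set R -> \bar R) (m : R) : Prop :=
  ((2^-1)%:E <= mu `]-oo, m]%classic)%E /\ ((2^-1)%:E <= mu `[m, +oo[%classic)%E.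

(* When several medians exist, [get] selects one of them by choice, and nothing
   more than [is_median] is known about it. *)
Definition median (mu : set R -> \bar R) : R := get [set m | is_median mu m].

Definition m1 (F : probability R R) : R := median F.

Definition m2 (F : probability R R) : R :=
  median (pushforward F (fun x : R => `|x - m1 F|)).

(* The inverse is taken in the extended reals, where 0^-1 = +oo and
   +oo * 0 = 0: if m2 F = 0, the interval must be reduced to a point. *)
Definition in_family (tbar B : R) (F : probability R R) : Prop :=
  (exists! m : R, is_median F m) /\
  forall x1 x2 : R,
    x1 \in `[QL F (2^-1 - tbar), QR F (2^-1 + tbar)] ->
    x2 \in `[QL F (2^-1 - tbar), QR F (2^-1 + tbar)] ->
    ((B * m2 F)%:E^-1 * `|x1 - x2|%:E <= `|cdf_of F x1 - cdf_of F x2|%:E)%E.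

Definition empirical_median (s : seq R) : R :=
  let v := sort <=%R s in
  let n := size s in
  if odd n then v`_(n./2) else (v`_(n./2).-1 + v`_(n./2)) / 2.

End Distributions.

Section Independence.
Context {R : realType} {d : measure_display} {Omega : measurableType d}.
Variable P : probability Omega R.

Definition independent_seq d' (S : measurableType d') (W : nat -> Omega -> S) :
    Prop :=
  forall (J : {fset nat}) (A : nat -> set S),
    (forall t, measurable (A t)) ->
    P (\bigcap_(t in [set` J]) (W t @^-1` A t)) =
    (\prod_(t <- J) P (W t @^-1` A t))%E.

Definition independent2 d1 (S1 : measurableType d1) d2 (S2 : measurableType d2)
    (V : Omega -> S1) (W : Omega -> S2) : Prop :=
  forall (A : set S1) (B : set S2), measurable A -> measurable B ->
    P ((V @^-1` A) `&` (W @^-1` B)) = (P (V @^-1` A) * P (W @^-1` B))%E.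

End Independence.

Inductive adversary := Oblivious | Prescient | Malicious.

Section Environment.
Context {R : realType} {d : measure_display} {Omega : measurableType d}.
Variable P : probability Omega R.
Variable k : nat.

Definition contaminated (Y : 'I_k -> nat -> {RV P >-> R})
    (D : 'I_k -> nat -> {RV P >-> bool}) (Z : 'I_k -> nat -> {RV P >-> R})
    (i : 'I_k) (t : nat) (w : Omega) : R :=
  (1 - (D i t w)%:R) * Y i t w + (D i t w)%:R * Z i t w.

(* For prescient and malicious adversaries, Z is an unconstrained family of
   random variables on Omega: its joint law with all the Y's and D's, including
   those of other arms and of future times, is arbitrary. *)
Definition admissible (adv : adversary) (Y : 'I_k -> nat -> {RV P >-> R})
    (D : 'I_k -> nat -> {RV P >-> bool}) (Z : 'I_k -> nat -> {RV P >-> R}) :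
    Prop :=
  match adv with
  | Oblivious => forall i,
      independent_seq P (fun t w => (Y i t w, D i t w, Z i t w)) /\
      forall t, independent2 P (Y i t) (D i t)
  | Prescient => forall i,
      independent_seq P (fun t w => (Y i t w, D i t w)) /\
      forall t, independent2 P (Y i t) (D i t)
  | Malicious => forall i,
      independent_seq P (fun t w => (Y i t w, D i t w))
  end.

Definition cbai_instance (adv : adversary) (eps : R)
    (F : 'I_k -> probability R R) (Y : 'I_k -> nat -> {RV P >-> R})
    (D : 'I_k -> nat -> {RV P >-> bool}) (Z : 'I_k -> nat -> {RV P >-> R}) :
    Prop :=
  [/\ forall i t (A : set R), measurable A -> distribution P (Y i t) A = F i A,
      forall i t (A : set bool),
        distribution P (D i t) A = bernoulli_prob eps A &
      admissible adv Y D Z].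

End Environment.

(* The internal randomness of the algorithm is a seed drawn once from seed_law.
   Decisions are functions of the seed and of the list of past observations;
   the arms pulled in the past can be recomputed from these. *)
Record algorithm (R : realType) (k : nat) := Algorithm {
  seed_display : measure_display;
  seed : measurableType seed_display;
  seed_law : probability seed R;
  pull : seed -> seq R -> 'I_k;
  stop : seed -> seq R -> bool;
  output : seed -> seq R -> 'I_k;
  measurable_pull : forall (n : nat) (i : 'I_k),
    measurable [set p : seed * n.-tuple R | pull p.1 p.2 = i];
  measurable_stop : forall n : nat,
    measurable [set p : seed * n.-tuple R | stop p.1 p.2];
  measurable_output : forall (n : nat) (i : 'I_k),
    measurable [set p : seed * n.-tuple R | output p.1 p.2 = i] }.

Section Run.
Context {R : realType} {k : nat}.
Variable alg : algorithm R k.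

(* x i t is the value that pulling arm i at iteration t reveals; iterations are
   numbered from 0. *)
Fixpoint history (s : seed alg) (x : 'I_k -> nat -> R) (t : nat) : seq R :=
  if t is u.+1 then
    let h := history s x u in rcons h (x (pull s h) u)
  else [::].

Definition stops_at (s : seed alg) (x : 'I_k -> nat -> R) (T : nat) : Prop :=
  stop s (history s x T) /\ forall u, (u < T)%N -> ~~ stop s (history s x u).

Definition sample_complexity_le (M : R) : Prop :=
  forall s x, exists2 T, stops_at s x T & T%:R <= M.

End Run.

Section PAC.
Context {R : realType}.
Variables (adv : adversary) (eps : R).

Definition bias : R :=
  if adv is Malicious then eps else eps / (2 * (1 - eps)).

Definition uncertainty (B : R) (F : probability R R) : R := B * m2 F * bias.

Definition effective_gap (B : R) (Fstar F : probability R R) : R :=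
  (m1 Fstar - uncertainty B Fstar) - (m1 F + uncertainty B F).

Definition best_arm k (F : 'I_k -> probability R R) (i : 'I_k) : Prop :=
  forall j, m1 (F j) <= m1 (F i).

(* Taking the product with seed_law makes the seed independent of all the
   random variables of the environment. *)
Definition PAC (tbar B m2bar : R) (k : nat) (alpha delta : R)
    (alg : algorithm R k) : Prop :=
  forall (d : measure_display) (Omega : measurableType d)
    (P : probability Omega R) (F : 'I_k -> probability R R)
    (Y : 'I_k -> nat -> {RV P >-> R}) (D : 'I_k -> nat -> {RV P >-> bool})
    (Z : 'I_k -> nat -> {RV P >-> R}),
    (forall i, in_family tbar B (F i)) ->
    (forall i, m2 (F i) <= m2bar) ->
    cbai_instance adv eps F Y D Z ->
    forall istar : 'I_k, best_arm F istar ->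
    ((1 - delta)%:E <= (P \x seed_law alg)
       [set p : Omega * seed alg | exists T : nat,
          let x i t := contaminated Y D Z i t p.1 in
          stops_at p.2 x T /\
          (effective_gap B (F istar) (F (output p.2 (history p.2 x T)))
             <= alpha)%R])%E.

Definition num_samples (tbar B m2bar alpha delta : R) : R :=
  2 * Num.max (B ^+ 2 * m2bar ^+ 2 / alpha ^+ 2) ((tbar - bias) ^- 2) *
  ln ((if adv is Malicious then 3 else 2) / delta).

End PAC.

Section MedianAlgorithm.
Context {R : realType} {k : nat}.

Definition arm_samples (sched : nat -> 'I_k) (h : seq R) (i : 'I_k) : seq R :=
  [seq h`_t | t <- iota 0 (size h) & sched t == i].

(* The order in which the arms are sampled is arbitrary, but fixed in advance;
   ties between maximal empirical medians are broken arbitrarily. *)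
Definition median_algorithm (N : nat) (alg : algorithm R k) : Prop :=
  exists2 sched : nat -> 'I_k,
    forall i, count (fun t => sched t == i) (iota 0 (k * N)) = N &
  forall (s : seed alg) (h : seq R),
    [/\ (size h < k * N)%N -> pull s h = sched (size h),
        (size h <= k * N)%N -> stop s h = (size h == k * N)%N &
        size h = (k * N)%N -> forall j,
          empirical_median (arm_samples sched h j) <=
          empirical_median (arm_samples sched h (output s h))].

End MedianAlgorithm.

(* Main.v *)
(* Every observation of arm i that falls in a set A forces either D = 1 or
   Y in A. These events do not involve Z, are independent over time, and for a
   ray A beyond m1 (F i) +/- (U_i + alpha / 2) each has probability at most
   (1 - s) / 2, where s is the square root of the inverse of the maximum in
   n_(alpha, delta): the regularity of the family bounds F i A by
   1/2 - bias - s. If the empirical median lands in such a ray, at least half of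
   the events occur, which by a Chernoff bound has probability at most
   exp (- s^2 N / 2). A union bound over the two rays and the k arms gives
   |hat p_i - m1 (F i)| <= U_i + alpha / 2 for all i at once, so that the arm with
   the largest empirical median has effective gap at most alpha. *)
Require Import Defs.
From HB Require Import structures.
From mathcomp Require Import all_boot all_order all_algebra.
From mathcomp Require Import finmap ring lra zify.
From mathcomp Require Import all_classical all_reals all_analysis.
Set Implicit Arguments.
Unset Strict Implicit.
Unset Printing Implicit Defensive.
Import Order.TTheory GRing.Theory Num.Theory.
Import numFieldNormedType.Exports measurable_realfun.
Local Open Scope classical_set_scope.
Local Open Scope ring_scope.

(** * Cdfs, quantiles and medians of laws on the real line *)

Section RealDistributions.
Context {R : realType}.
Implicit Types (F : probability R R) (p x y m : R).

Lemma cdf_ofE F x : (cdf_of F x)%:E = F `]-oo, x]%classic.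
Proof. by rewrite /cdf_of fineK// fin_num_measure. Qed.

Lemma cdf_of_homo F : {homo cdf_of F : x y / x <= y}.
Proof.
move=> x y xy; rewrite -lee_fin !cdf_ofE le_measure ?inE//.
by apply: subset_itvl; rewrite bnd_simp.
Qed.

Section Limits.
(** Under [F] the identity is a random variable of law [F], which gives access to the limits of cdfs
    of random variables. *)
Let id_R : R -> R := idfun.
#[local] HB.instance Definition _ :=
  @isMeasurableFun.Build _ _ _ _ id_R (@measurable_id _ _ setT).

Lemma cvg_cdf_ofNy F : cdf_of F x @[x --> -oo] --> (0 : R).
Proof. by have /fine_cvgP[] := cvg_cdfNy0 (id_R : {RV F >-> R}). Qed.

Lemma cvg_cdf_ofy F : cdf_of F x @[x --> +oo] --> (1 : R).
Proof. by have /fine_cvgP[] := cvg_cdfy1 (id_R : {RV F >-> R}). Qed.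

End Limits.

(** Since the cdf tends to 0 at [-oo] and [p] is positive, the set under the infimum is bounded
    below, so [inf] is a genuine infimum there. *)
Lemma QL_le F (p x : R) : 0 < p -> p <= cdf_of F x -> QL F p <= x.
Proof.
move=> p0 px; apply: ge_inf => //.
have [M [_ MF]] : \forall y \near -oo, cdf_of F y < p.
  exact: cvgr_lt (cvg_cdf_ofNy F) _ p0.
exists (M - 1) => y /= py; rewrite leNgt; apply/negP => yM.
have /MF : y < M by lra.
by rewrite ltNge py.
Qed.

Lemma QR_neq0 F (p : R) : p < 1 -> [set x | p < cdf_of F x] !=set0.
Proof.
move=> p1; have [M [_ MF]] : \forall y \near +oo, p < cdf_of F y.
  exact: cvgr_gt (cvg_cdf_ofy F) _ p1.
by exists (M + 1); apply: MF; rewrite ltrDl.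
Qed.

Lemma QR_lt F (p x : R) : p < 1 -> QR F p < x -> p < cdf_of F x.
Proof.
move=> p1 /(inf_lt (QR_neq0 F p1))[y /= py yx].
exact: lt_le_trans py (cdf_of_homo F (ltW yx)).
Qed.

Lemma le_QR F (p x : R) : p < 1 -> (forall y, y < x -> cdf_of F y <= p) -> x <= QR F p.
Proof.
move=> p1 xp; apply: lb_le_inf (QR_neq0 F p1) _ => y /= py.
by rewrite leNgt; apply/negP => /xp; rewrite leNgt py.
Qed.

Lemma is_median_cdf_of_ge F (m : R) : is_median F m -> 2^-1 <= cdf_of F m.
Proof. by case; rewrite -cdf_ofE. Qed.

Lemma is_median_cdf_of_le F (m x : R) : is_median F m -> x < m -> cdf_of F x <= 2^-1.
Proof.
move=> [_ Fm] xm; rewrite -lee_fin cdf_ofE.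
have : (F `]-oo, x]%classic <= F (~` `[m, +oo[%classic))%E.
  apply: le_measure; rewrite ?inE//; first exact: measurableC.
  by rewrite setCitvr => y /=; rewrite !in_itv/= => /le_lt_trans; exact.
rewrite probability_setC// => /le_trans; apply.
rewrite leeBlDr ?fin_num_measure//.
by apply: le_trans (leeD2l _ Fm); rewrite -EFinD lee_fin; lra.
Qed.

(* Without a median, [median] is the default point of R, which is 0. *)
Lemma m2_ge0 F : 0 <= m2 F.
Proof.
rewrite /m2 /median.
set P := [set m | _]; have [[m Pm]|nP] := pselect (exists m, P m); last first.
  by rewrite getPN// => m Pm; apply: nP; exists m.
have [+ _] := getPex (ex_intro _ m Pm); apply: contra_leT; rewrite -ltNge => m0.
rewrite /pushforward (_ : _ @^-1` _ = set0) ?measure0 ?lte_fin//.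
apply/seteqP; split => // x /=; rewrite in_itv/= => /le_lt_trans/(_ m0).
by rewrite ltNge normr_ge0.
Qed.

(** * Growth of the cdf around the median for laws of the family *)

Section Family.
Context {tbar B : R} {F : probability R R}.
Local Notation I := `[QL F (2^-1 - tbar), QR F (2^-1 + tbar)].

Lemma in_family_m1 : in_family tbar B F -> is_median F (m1 F).
Proof. by case=> -[m [Fm _]] _; exact: getI Fm. Qed.

Lemma in_family_m1_itv :
  0 < tbar < 2^-1 -> in_family tbar B F -> m1 F \in I.
Proof.
move=> /andP[t0 t2] /in_family_m1 m1P; rewrite in_itv/=; apply/andP; split.
  apply: QL_le; first lra.
  by have := is_median_cdf_of_ge m1P; lra.
by apply: le_QR => [|y /(is_median_cdf_of_le m1P)]; lra.
Qed.

(** Clearing the denominator covers [m2 F = 0] as well: the inverse is then infinite, which forces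
    [x = y]. *)
Lemma in_family_dist x y : 0 < B -> in_family tbar B F ->
  x \in I -> y \in I -> x <= y ->
  y - x <= B * m2 F * (cdf_of F y - cdf_of F x).
Proof.
move=> B0 [_ BF] xI yI xy; have := BF _ _ yI xI.
rewrite !ger0_norm ?subr_ge0 ?cdf_of_homo// inver; case: ifPn => [/eqP ->|Bm0].
  rewrite mul0r; case: (ltgtP x y) xy => // [xy _|-> _]; last by rewrite subrr.
  by rewrite gt0_mulye ?lte_fin ?subr_gt0// leye_eq.
rewrite -EFinM lee_fin ler_pdivrMl// lt_neqAle eq_sym Bm0.
by rewrite mulr_ge0 ?m2_ge0// ltW.
Qed.

Variables b s a : R.

(** The cdf is at least 1/2 at the median. A point still inside the quantile interval gains [b + s]
    by regularity; a point past the right quantile already has cdf above [2^-1 + tbar]. *)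
Lemma in_family_cdf_of_ge : 0 < tbar < 2^-1 -> 0 < B -> in_family tbar B F ->
  0 <= b -> 0 < s -> b + s <= tbar -> 0 < a -> B * m2 F * s <= a ->
  2^-1 + (b + s) <= cdf_of F (m1 F + (B * m2 F * b + a)).
Proof.
move=> t02 B0 Ffam b0 s0 bst a0 sa; set x := m1 F + _.
have /andP[t0 t2] := t02; have mI := in_family_m1_itv t02 Ffam.
have /andP[Qm mQ] := mI.
have Bm0 : 0 <= B * m2 F by rewrite mulr_ge0 ?m2_ge0 ?ltW.
have Bmb := mulr_ge0 Bm0 b0.
have mx : m1 F <= x by rewrite /x; lra.
have [xQ|Qx] := leP x (QR F (2^-1 + tbar)); last first.
  have hi1 : 2^-1 + tbar < 1 by lra.
  by have : 2^-1 + tbar < cdf_of F x := QR_lt hi1 Qx; lra.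
have xI : x \in I by rewrite in_itv/= xQ (le_trans _ mx).
have := in_family_dist B0 Ffam mI xI mx.
have := is_median_cdf_of_ge (in_family_m1 Ffam).
rewrite {1 2}/x; set f := cdf_of F _; set g := cdf_of F _ => f2 fg.
(* If this scale were 0, the distance bound would give [a <= 0]. *)
have Bm_gt0 : 0 < B * m2 F.
  rewrite lt_neqAle Bm0 andbT.
  by apply: contraTneq a0 => Bm; rewrite -Bm in fg *; lra.
have : B * m2 F * (b + s) <= B * m2 F * (g - f) by lra.
rewrite ler_pM2l//; lra.
Qed.

(** This is not the mirror image of the upper bound: an atom at the median can push the cdf there
    above 1/2. Regularity is therefore applied up to points strictly left of the median, where the
    cdf is at most 1/2. *)
Lemma in_family_cdf_of_le : 0 < tbar < 2^-1 -> 0 < B -> in_family tbar B F ->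
  0 <= b -> 0 < s -> b + s <= tbar -> 0 < a -> B * m2 F * s <= a ->
  cdf_of F (m1 F - (B * m2 F * b + a)) <= 2^-1 - (b + s).
Proof.
move=> t02 B0 Ffam b0 s0 bst a0 sa; set x := m1 F - _.
have /andP[t0 t2] := t02; have mI := in_family_m1_itv t02 Ffam.
have /andP[Qm mQ] := mI.
have Bm0 : 0 <= B * m2 F by rewrite mulr_ge0 ?m2_ge0 ?ltW.
have Bmb := mulr_ge0 Bm0 b0.
have mx : x < m1 F by rewrite /x; lra.
have [Qx|xQ] := leP (QL F (2^-1 - tbar)) x; last first.
  have lo0 : 0 < 2^-1 - tbar by lra.
  have : cdf_of F x < 2^-1 - tbar.
    by rewrite ltNge; apply/negP => /(QL_le lo0); rewrite leNgt xQ.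
  by lra.
have xI : x \in I by rewrite in_itv/= Qx (le_trans (ltW mx)).
have m1P := in_family_m1 Ffam; have x2 := is_median_cdf_of_le m1P mx.
pose c := B * m2 F * (2^-1 - cdf_of F x).
have c0 : 0 <= c by rewrite mulr_ge0// subr_ge0.
have mxc : m1 F - x <= c.
  (* The midpoint of [x + c] and the median lies left of the median yet farther than [c] from [x],
     against regularity between [x] and [y]. *)
  rewrite leNgt; apply/negP => cm; pose y := (x + c + m1 F) / 2.
  have ym : y < m1 F by rewrite /y; lra.
  have xy : x <= y by rewrite /y; lra.
  have yI : y \in I by rewrite in_itv/= (le_trans Qx)// (le_trans (ltW ym)).
  have := in_family_dist B0 Ffam xI yI xy.
  have y2 := is_median_cdf_of_le m1P ym.
  have : B * m2 F * (cdf_of F y - cdf_of F x) <= c.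
    by apply: ler_wpM2l => //; lra.
  by rewrite /y; lra.
move: mxc; rewrite {1}/x /c; set f := cdf_of F _ => mxc.
have Bm_gt0 : 0 < B * m2 F.
  rewrite lt_neqAle Bm0 andbT.
  by apply: contraTneq a0 => Bm; rewrite -Bm in mxc *; lra.
have : B * m2 F * (b + s) <= B * m2 F * (2^-1 - f) by lra.
rewrite ler_pM2l//; lra.
Qed.

End Family.
End RealDistributions.

(** * Counting samples beyond the empirical median *)

Section EmpiricalMedian.
Context {R : realType}.
Implicit Types (s : seq R) (x : R).

(** The upper middle value is at least the empirical median, so it exceeds [x], and so does
    everything after it in sorted order: at least half of the list. *)
Lemma empirical_median_gt s x : x < empirical_median s ->
  (size s <= 2 * count (fun y => (x < y)%R) s)%N.
Proof.
rewrite /empirical_median; set v := sort _ s.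
have [szv cv] : size v = size s /\ count (fun y => x < y) v = count (fun y => x < y) s.
  by rewrite size_sort; split => //; apply/permP; rewrite perm_sort.
have vs : sorted <=%R v by exact: sort_le_sorted.
rewrite -szv -cv; set n := size v; move: (odd_double_half n) => nE.
have count_ge i : (i < n)%N -> x < v`_i -> (n - i <= count (fun y => (x < y)%R) v)%N.
  move=> ilt xi; rewrite -[in X in (_ <= X)%N](cat_take_drop i v) count_cat.
  apply: leq_trans (leq_addl _ _); rewrite -size_drop leq_eqVlt eq_sym.
  apply/orP; left; rewrite -all_count; apply/(all_nthP 0) => j.
  rewrite size_drop nth_drop => jlt; apply: lt_le_trans xi _.
  apply: le_sorted_leq_nth => //; rewrite ?inE ?leq_addr//.
  by rewrite -ltn_subRL.
case: (posnP n) => [->//|n0]; case: ifPn => [on xm|en xm].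
  by have := count_ge n./2 _ xm; rewrite on in nE; lia.
rewrite (negbTE en) in nE.
have le12 : v`_(n./2).-1 <= v`_n./2.
  by apply: le_sorted_leq_nth => //; rewrite ?inE -?[size v]/n; lia.
have xv : x < v`_n./2 by lra.
by have := count_ge n./2 _ xv; lia.
Qed.

Lemma empirical_median_lt s x : empirical_median s < x ->
  (size s <= 2 * count (fun y => (y < x)%R) s)%N.
Proof.
rewrite /empirical_median; set v := sort _ s.
have [szv cv] : size v = size s /\ count (fun y => y < x) v = count (fun y => y < x) s.
  by rewrite size_sort; split => //; apply/permP; rewrite perm_sort.
have vs : sorted <=%R v by exact: sort_le_sorted.
rewrite -szv -cv; set n := size v; move: (odd_double_half n) => nE.
have count_ge i : (i < n)%N -> v`_i < x -> (i < count (fun y => (y < x)%R) v)%N.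
  move=> ilt xi; rewrite -[in X in (_ < X)%N](cat_take_drop i.+1 v) count_cat.
  apply: leq_trans (leq_addr _ _).
  have sz : size (take i.+1 v) = i.+1 by rewrite size_take_min; apply/minn_idPl.
  rewrite -[X in (X <= _)%N]sz leq_eqVlt eq_sym.
  apply/orP; left; rewrite -all_count; apply/(all_nthP 0) => j.
  rewrite sz => jlt; rewrite nth_take//; apply: le_lt_trans _ xi.
  by apply: le_sorted_leq_nth => //; rewrite ?inE -?[size v]/n; lia.
case: (posnP n) => [->//|n0]; case: ifPn => [on xm|en xm].
  by have := count_ge n./2 _ xm; rewrite on in nE; lia.
rewrite (negbTE en) in nE.
have le12 : v`_(n./2).-1 <= v`_n./2.
  by apply: le_sorted_leq_nth => //; rewrite ?inE -?[size v]/n; lia.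
have xv : v`_(n./2).-1 < x by lra.
by have := count_ge _ _ xv; lia.
Qed.

End EmpiricalMedian.

(** * Runs that follow a fixed sampling schedule *)

Section Histories.
Context {R : realType} {k N : nat} {alg : algorithm R k} {sched : nat -> 'I_k}.
Hypothesis pullE : forall (s : seed alg) (h : seq R),
  (size h < k * N)%N -> pull s h = sched (size h).
Hypothesis stopE : forall (s : seed alg) (h : seq R),
  (size h <= k * N)%N -> stop s h = (size h == k * N)%N.

(** Pulls depend only on the length of the history, so the recursion unrolls into a list independent
    of the seed. *)
Lemma history_mkseq (s : seed alg) (x : 'I_k -> nat -> R) t : (t <= k * N)%N ->
  history s x t = mkseq (fun u => x (sched u) u) t.
Proof.
elim: t => [//|t IH] tkN; rewrite mkseqS -IH ?(ltnW tkN)//=.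
by rewrite pullE IH ?size_mkseq ?(ltnW tkN).
Qed.

Lemma stops_at_mulkN (s : seed alg) x : stops_at s x (k * N).
Proof.
split=> [|u ukN]; first by rewrite stopE history_mkseq ?size_mkseq.
by rewrite stopE history_mkseq ?size_mkseq ?(ltnW ukN)// ltn_eqF.
Qed.

Lemma arm_samples_history (s : seed alg) x i :
  arm_samples sched (history s x (k * N)) i =
  [seq x i t | t <- iota 0 (k * N) & sched t == i].
Proof.
rewrite history_mkseq// /arm_samples size_mkseq; apply/eq_in_map => t.
by rewrite mem_filter mem_iota add0n => /andP[/eqP <- tkN]; rewrite nth_mkseq.
Qed.

End Histories.

(** * A Chernoff bound for the number of independent events that occur *)

Section Chernoff.
Context {R : realType} {d : measure_display} {Omega : measurableType d}.
Context {P : probability Omega R} {T : choiceType} {E : T -> set Omega}.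
Hypothesis mE : forall t, measurable (E t).
Hypothesis indepE : forall J : seq T, uniq J ->
  P (\bigcap_(t in [set` J]) E t) = (\prod_(t <- J) P (E t))%E.

Let p t := fine (P (E t)).

Lemma fine_probE t : P (E t) = (p t)%:E.
Proof. by rewrite /p fineK// fin_num_measure. Qed.

Lemma fine_prob_ge0 t : 0 <= p t. Proof. exact: fine_ge0. Qed.

Lemma measurable_big_event (K : seq T) : measurable (\bigcap_(t in [set` K]) E t).
Proof. by apply: fin_bigcap_measurable => //; exact: finite_seq. Qed.

Lemma measurable_prod_indic (c : R) (r : seq T) :
  measurable_fun setT (fun w => \prod_(t <- r) (1 + c * \1_(E t) w)).
Proof.
apply: measurable_prod => t _; apply: measurable_funD => //.
by apply: measurable_funM => //; exact: measurable_indic.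
Qed.

(* The set K carries the events already expanded; it makes the induction over r
   go through. *)
Lemma integral_prod_indic (c : R) (r K : seq T) : 0 <= c -> uniq (r ++ K) ->
  (\int[P]_w (\prod_(t <- r) (1 + c * \1_(E t) w) *
              \1_(\bigcap_(t in [set` K]) E t) w)%:E)%E =
  (\prod_(t <- r) (1 + c * p t) * \prod_(t <- K) p t)%:E.
Proof.
move=> c0; elim: r K => [|t r IH] K uK.
  under eq_integral do rewrite big_nil mul1r.
  rewrite integral_indic//; last exact: measurable_big_event.
  rewrite setIT big_nil mul1r -prodEFin; apply: etrans (indepE uK) _.
  by apply: eq_bigr => t _; rewrite fine_probE.
pose f (r' K' : seq T) w : R :=
  \prod_(u <- r') (1 + c * \1_(E u) w) * \1_(\bigcap_(u in [set` K']) E u) w.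
have mf r' K' : measurable_fun [set: Omega] (EFin \o f r' K').
  apply/measurable_EFinP/measurable_funM.
    exact: measurable_prod_indic.
  by apply: measurable_indic; exact: measurable_big_event.
have f0 r' K' w : (0 <= (f r' K' w)%:E)%E.
  rewrite lee_fin mulr_ge0// prodr_ge0// => u _.
  by rewrite addr_ge0// mulr_ge0.
have uK2 : uniq (r ++ t :: K) by rewrite (perm_uniq (permEl (perm_catCA r [:: t] K))).
have uK1 : uniq (r ++ K) by move: uK => /= /andP[].
(* Expanding the factor of [t] gives two integrals; in the second, [t] moves from [r] to [K].
   Independence enters only once [r] is empty. *)
transitivity (\int[P]_w ((f r K w)%:E + c%:E * (f r (t :: K) w)%:E))%E.
  apply: eq_integral => w _; rewrite -EFinM -EFinD; congr (_%:E).
  by rewrite /f !bigcap_seq !big_cons indicI /=; ring.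
have mcf : measurable_fun [set: Omega] (fun w => c%:E * (f r (t :: K) w)%:E)%E.
  by apply: measurable_funeM; exact: mf.
rewrite ge0_integralD//; [|exact: mf|by move=> w _; rewrite mule_ge0].
rewrite ge0_integralZl//; last exact: mf.
rewrite /f !IH// -EFinM -EFinD !big_cons; congr (_%:E); ring.
Qed.

Lemma measurable_count_ge (J : seq T) n :
  measurable [set w | (n <= 2 * count (fun t => w \in E t) J)%N].
Proof.
rewrite (_ : [set _ | _] =
    setT `&` [set w | n%:R <= 2 * \sum_(t <- J) (\1_(E t) w : R)]).
  apply: measurable_fun_le => //; apply: measurable_funM => //.
  by apply: measurable_sum => t; exact: measurable_indic.
rewrite setTI; apply/seteqP; split=> w /=;
  rewrite (_ : \sum_(t <- J) _ = (count (fun t => w \in E t) J)%:R)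
    -?natrM ?ler_nat//;
  rewrite -sum1_count natr_sum [RHS]big_mkcond/=;
  by apply: eq_bigr => t _; rewrite indicE; case: ifP.
Qed.

(* Markov's inequality for [lambda ^ count] with [lambda = (1 + s) / (1 - s)];
   the square root of [lambda] absorbs the threshold at half of [size J]. *)
Lemma prob_majority_le (J : seq T) (s : R) : uniq J -> 0 < s < 1 ->
  (forall t, (P (E t) <= ((1 - s) / 2)%:E)%E) ->
  (P [set w | (size J <= 2 * count (fun t => w \in E t) J)%N] <=
   (expR (- (s ^+ 2 / 2 * (size J)%:R)))%:E)%E.
Proof.
move=> uJ /andP[s0 s1] PE; set G := [set w | _].
have mG : measurable G by exact: measurable_count_ge.
pose la := (1 + s) / (1 - s); pose mu := Num.sqrt la; pose c := la - 1.
have la1 : 1 <= la by rewrite /la ler_pdivlMr; lra.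
have c0 : 0 <= c by rewrite subr_ge0.
have mu2 : mu ^+ 2 = la by rewrite sqr_sqrtr; lra.
have mu1 : 1 <= mu by rewrite -[1]sqrtr1 ler_sqrt; lra.
have pw w :
    \prod_(t <- J) (1 + c * \1_(E t) w) = mu ^+ (2 * count (fun t => w \in E t) J).
  rewrite exprM mu2; elim: (J) => [|t r IH]; first by rewrite big_nil expr0.
  rewrite big_cons IH /= exprD indicE /c; congr (_ * _).
  by case: (w \in E t); rewrite ?expr1 ?expr0 ?mulr1 ?mulr0; ring.
(* Markov: on [G] the exponent [2 * count] is at least [size J], and [mu >= 1]. *)
have GI : ((mu ^+ size J)%:E * P G <= (\prod_(t <- J) (1 + c * p t))%:E)%E.
  have := @integral_prod_indic c J [::] c0; rewrite cats0 => /(_ uJ).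
  rewrite bigcap_seq !big_nil indicT mulr1 => <-.
  rewrite (_ : P G = \int[P]_w (\1_G w)%:E)%E; last by rewrite integral_indic// setIT.
  rewrite -ge0_integralZl//; last 2 first.
  - by apply/measurable_EFinP; exact: measurable_indic.
  - by rewrite lee_fin exprn_ge0; lra.
  apply: ge0_le_integral => //.
  - by move=> w _; rewrite mule_ge0// lee_fin exprn_ge0; lra.
  - by apply: measurable_funeM; apply/measurable_EFinP; exact: measurable_indic.
  - apply/measurable_EFinP/measurable_funM => //.
    exact: measurable_prod_indic.
  move=> w _; rewrite -EFinM lee_fin pw indicE.
  rewrite /cst mulr1; case: (boolP (w \in G)) => [|_];
    rewrite ?mulr1 ?mulr0 ?exprn_ge0//; last by lra.
  by rewrite inE => Gw; rewrite ler_weXn2l.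
(* Here [c = 2 * s / (1 - s)], so that [c * ((1 - s) / 2) = s]. *)
have ub : \prod_(t <- J) (1 + c * p t) <= (1 + s) ^+ size J.
  rewrite (_ : _ ^+ _ = \prod_(t <- J) (1 + s)); last first.
    by rewrite big_const_seq count_predT iter_mulr_1.
  rewrite !big_seq; apply: ler_prod => t _.
  rewrite addr_ge0 ?mulr_ge0 ?fine_prob_ge0//=.
  have := PE t; rewrite fine_probE lee_fin => pt.
  have -> : 1 + s = 1 + c * ((1 - s) / 2) by rewrite /c /la; field; lra.
  by rewrite lerD2l ler_wpM2l.
have mu0 : 0 < mu by lra.
(* The square of the left side is [(1 + s) * (1 - s) = 1 - s ^+ 2], at most [expR (- s ^+ 2)]. *)
have base : (1 + s) / mu <= expR (- (s ^+ 2 / 2)).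
  rewrite -(@ler_pXn2r _ 2)// ?nnegrE ?expR_ge0 ?divr_ge0//; try lra.
  rewrite -expRM_natl exprMn exprVn mu2 (_ : _ * _ = 1 + - s ^+ 2); last first.
    by rewrite /la; field; lra.
  by rewrite (_ : 2%:R * _ = - s ^+ 2) ?expR_ge1Dx//; field.
have : (P G <= (((1 + s) / mu) ^+ size J)%:E)%E.
  rewrite exprMn exprVn mulrC EFinM lee_pdivlMl ?exprn_gt0//.
  by rewrite (le_trans GI)// lee_fin.
move=> /le_trans; apply; rewrite lee_fin.
have -> : - (s ^+ 2 / 2 * (size J)%:R) = (size J)%:R * - (s ^+ 2 / 2) by ring.
rewrite expRM_natl; apply: lerXn2r; rewrite ?nnegrE ?expR_ge0 ?divr_ge0//; lra.
Qed.

End Chernoff.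

(** * Events that bound the influence of the adversary *)

Section Contamination.
Context {R : realType} {d : measure_display} {Omega : measurableType d}.
Context {P : probability Omega R}.

Lemma independent_seq_bigcap d' (S : measurableType d') (W : nat -> Omega -> S)
    (A : set S) (J : seq nat) :
  independent_seq P W -> measurable A -> uniq J ->
  P (\bigcap_(t in [set` J]) W t @^-1` A) = (\prod_(t <- J) P (W t @^-1` A))%E.
Proof.
move=> /(_ [fset t in J]%fset (fun=> A)) indepW mA uJ.
rewrite (_ : [set` J] = [set` [fset t in J]%fset]); last first.
  by apply/seteqP; split=> t /=; rewrite inE.
rewrite indepW//; apply: perm_big; apply: uniq_perm => // t.
by rewrite inE.
Qed.

Context {k : nat} {adv : adversary} {eps : R} {F : 'I_k -> probability R R}.
Context {Y : 'I_k -> nat -> {RV P >-> R}} {D : 'I_k -> nat -> {RV P >-> bool}}.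
Context {Z : 'I_k -> nat -> {RV P >-> R}}.

(* A superset of [{X_(i,t) in A}] on which Z has no influence: the adversary is
   conceded every contaminated observation. *)
Definition conceded (A : set R) (i : 'I_k) (t : nat) : set Omega :=
  (fun w => (Y i t w, D i t w)) @^-1` (A `*` setT `|` setT `*` [set true]).

Lemma contaminated_conceded A i t w :
  contaminated Y D Z i t w \in A -> w \in conceded A i t.
Proof.
rewrite !inE /contaminated /conceded /=; case: (D i t w); first by right.
by rewrite subr0 mul1r mul0r addr0; left.
Qed.

Let mA2 (A : set R) : measurable A ->
  measurable (A `*` setT `|` setT `*` [set true] : set (R * bool)).
Proof. by move=> mA; apply: measurableU; exact: measurableX. Qed.

Lemma measurable_conceded A i t : measurable A -> measurable (conceded A i t).
Proof.
move=> mA; rewrite -[conceded _ _ _]setTI.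
have mYD : measurable_fun setT (fun w => (Y i t w, D i t w)).
  exact: measurable_fun_pair.
exact: mYD (mA2 mA).
Qed.

Lemma admissible_independent_seq i : admissible adv Y D Z ->
  independent_seq P (fun t w => (Y i t w, D i t w)).
Proof.
(* Only the oblivious case needs work: independence of the triples is applied to cylinders that
   leave [Z] free. *)
case: adv => /= [/(_ i)[indep _]|/(_ i)[]//|//] J A mA.
have /= := indep J (fun t => A t `*` setT) (fun t => measurableX (mA t) measurableT).
have EA t : (fun w => (Y i t w, D i t w, Z i t w)) @^-1` (A t `*` setT) =
            (fun w => (Y i t w, D i t w)) @^-1` (A t).
  by apply/seteqP; split=> w /= => [[]//|//].
by under eq_bigcapr do rewrite EA; under eq_bigr do rewrite EA.
Qed.

(** The bias is what makes 1/2 the threshold: it offsets contamination through a union bound for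
    malicious adversaries, and through the product rule for the complement when [Y] and [D] are
    independent. *)
Lemma prob_conceded_le A i t (s : R) :
  0 < eps < 2^-1 -> 0 < s -> cbai_instance adv eps F Y D Z -> measurable A ->
  (F i A <= (2^-1 - (bias adv eps + s))%:E)%E ->
  (P (conceded A i t) <= ((1 - s) / 2)%:E)%E.
Proof.
move=> /andP[e0 e2] s0 [YF Deps adm] mA FA.
have e01 : 0 <= eps <= 1 by apply/andP; split; lra.
have YA : P (Y i t @^-1` A) = F i A := YF i t A mA.
have FAfin : F i A \is a fin_num by rewrite fin_num_measure.
have indepP : adv <> Malicious -> independent2 P (Y i t) (D i t).
  by move: adm; case: adv => // /(_ i)[_ /(_ t)].
have mYA : measurable (Y i t @^-1` A).
  by rewrite -[_ @^-1` _]setTI; exact: measurable_funP.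
have mD b : measurable (D i t @^-1` [set b]).
  by rewrite -[_ @^-1` _]setTI; exact: measurable_funP.
have [advM|advN] : adv = Malicious \/ adv <> Malicious by case: adv; [right|right|left].
  move: FA; rewrite advM /= => FA.
  have -> : conceded A i t = Y i t @^-1` A `|` D i t @^-1` [set true].
    apply/seteqP; split=> w; rewrite /conceded /=.
      by move=> [[? _]|[_ ?]]; [left|right].
    by move=> [|]; [left|right].
  apply: le_trans (measureU2 _ _ _) _ => //.
  have DT : P (D i t @^-1` [set true]) = eps%:E.
    have := Deps i t [set true]; rewrite /distribution /pushforward => ->.
    rewrite bernoulli_probE// !diracE mem_set// memNset// mule0 adde0 mule1//.
  rewrite [X in (X + _)%E]YA [X in (_ + X)%E]DT; apply: le_trans (leeD2r _ FA) _.
  rewrite -EFinD lee_fin; lra.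
(* An observation is not conceded exactly when it is clean and [Y] misses [A]; independence factors
   this event. *)
have -> : conceded A i t = ~` (Y i t @^-1` (~` A) `&` D i t @^-1` [set false]).
  apply/seteqP; split=> w; rewrite /conceded /=.
    by move=> [[Aw _] [//]|[_ ->] []].
  move=> h; have [Aw|nA] := pselect (A (Y i t w)); first by left.
  right; split => //; case E : (D i t w) => //; exfalso; exact: h.
have mYAC : measurable (Y i t @^-1` (~` A)).
  by rewrite preimage_setC; exact: measurableC.
rewrite probability_setC; last exact: measurableI.
rewrite indepP//; last exact: measurableC.
have DF : P (D i t @^-1` [set false]) = (1 - eps)%:E.
  have := Deps i t [set false]; rewrite /distribution /pushforward => ->.
  by rewrite bernoulli_probE// !diracE memNset// mem_set// mule0 add0e mule1.
rewrite [X in (_ * X)%E]DF preimage_setC probability_setC// YA.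
move: FA; rewrite -(fineK FAfin) -!(EFinN, EFinD, EFinM) !lee_fin; set f := fine _.
have -> : bias adv eps = eps / (2 * (1 - eps)) by case: adv advN.
set b := eps / _ => fle.
have bE : b * (1 - eps) = eps / 2 by rewrite /b; field; lra.
have : (2^-1 + b + s) * (1 - eps) <= (1 - f) * (1 - eps) by rewrite ler_wpM2r; lra.
rewrite !mulrDl bE => h.
(* As [eps < 1/2], at least half of the margin [s] survives the factor [1 - eps]; this is the source
   of the bound [(1 - s) / 2]. *)
have : s * 2^-1 <= s * (1 - eps) by rewrite ler_pM2l; lra.
by lra.
Qed.

Definition conceded_majority (A : set R) (i : 'I_k) (J : seq nat) : set Omega :=
  [set w | (size J <= 2 * count (fun t => w \in conceded A i t) J)%N].

Lemma measurable_conceded_majority A i J : measurable A ->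
  measurable (conceded_majority A i J).
Proof.
move=> mA; apply: (measurable_count_ge (R := R)) => t.
exact: measurable_conceded.
Qed.

Lemma prob_conceded_majority_le A i J (s : R) :
  0 < eps < 2^-1 -> 0 < s < 1 -> cbai_instance adv eps F Y D Z -> measurable A ->
  (F i A <= (2^-1 - (bias adv eps + s))%:E)%E -> uniq J ->
  (P (conceded_majority A i J) <= (expR (- (s ^+ 2 / 2 * (size J)%:R)))%:E)%E.
Proof.
move=> epsP sP inst mA FA uJ; apply: prob_majority_le => //.
- by move=> t; exact: measurable_conceded.
- have [_ _ adm] := inst; move=> K uK.
  exact: independent_seq_bigcap (admissible_independent_seq i adm) (mA2 mA) uK.
- by have /andP[s0 _] := sP; move=> t; exact: prob_conceded_le inst mA FA.
Qed.

(** A median outside [[lo, hi]] puts at least half of the observations in one of the rays, and each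
    of these is conceded. *)
Lemma empirical_median_bounds i (J : seq nat) (lo hi : R) w :
  ~ conceded_majority `]hi, +oo[ i J w -> ~ conceded_majority `]-oo, lo[ i J w ->
  lo <= empirical_median [seq contaminated Y D Z i t w | t <- J] <= hi.
Proof.
move=> nhi nlo; apply/andP; split; rewrite leNgt; apply/negP.
  move=> /empirical_median_lt; rewrite size_map count_map => h; apply: nlo.
  apply: leq_trans h _; rewrite leq_mul2l sub_count// => t /= tlo.
  by apply: contaminated_conceded; rewrite inE/= in_itv.
move=> /empirical_median_gt; rewrite size_map count_map => h; apply: nhi.
apply: leq_trans h _; rewrite leq_mul2l sub_count// => t /= tlo.
by apply: contaminated_conceded; rewrite inE/= in_itv/= andbT.
Qed.

End Contamination.

(* No measurability of A is needed: both sides are integrals of nonnegative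
   functions, i.e. suprema over the simple functions below them. *)
Lemma product_measure1_ge_setX {R : realType} d1 d2 (T1 : measurableType d1)
    (T2 : measurableType d2) (P : probability T1 R) (Q : probability T2 R)
    (G : set T1) (A : set (T1 * T2)) :
  measurable G -> (forall w v, G w -> A (w, v)) -> (P G <= (P \x Q) A)%E.
Proof.
move=> mG GA; rewrite /product_measure1 ge0_integralTE//.
apply: ereal_sup_ubound; exists (indic_nnsfun R mG); last first.
  by rewrite sintegral_indic// setIT.
move=> w; rewrite /= /mindic indicE.
case: (boolP (w \in G)) => [|_]; last exact: measure_ge0.
rewrite inE => Gw; rewrite (_ : xsection A w = setT) ?probability_setT//.
by apply/seteqP; split => // v _; rewrite /xsection/= inE; exact: GA.
Qed.

Lemma prob_bigcup_ord_le {R : realType} d (T : measurableType d)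
    (P : probability T R) (k : nat) (A : 'I_k -> set T) (e : R) :
  (forall i, measurable (A i)) -> (forall i, (P (A i) <= (e / k%:R)%:E)%E) ->
  (0 < k)%N -> (P (\big[setU/set0]_(i < k) A i) <= e%:E)%E.
Proof.
move=> mA PA k0.
have UA : (P (\big[setU/set0]_(i < k) A i) <= \sum_(i < k) P (A i))%E.
  elim: (index_enum _) => [|i r IH]; first by rewrite !big_nil measure0.
  rewrite !big_cons; apply: le_trans (leeD2l _ IH).
  by apply: measureU2 => //; exact: bigsetU_measurable.
apply: le_trans UA _; apply: (le_trans (lee_sum _ (fun i _ => PA i))).
rewrite sumEFin big_const_ord iter_addr_0.
by rewrite -(mulr_natr (e / k%:R)) divfK// pnatr_eq0 -lt0n.
Qed.

(** * Estimates on the number of samples per arm *)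

Section SampleSize.
Context {R : realType}.
Variables (adv : adversary) (eps tbar B m2bar : R).
Local Notation b := (bias adv eps).

Lemma bias_gt0 : 0 < eps < 2^-1 -> 0 < b.
Proof.
move=> /andP[e0 e2]; rewrite /bias; case: adv => //;
  by rewrite divr_gt0//; lra.
Qed.

Let maxterm (a : R) := Num.max (B ^+ 2 * m2bar ^+ 2 / a ^+ 2) ((tbar - b) ^- 2).
Let logterm (delta : R) := ln ((if adv is Malicious then 3 else 2) / delta).

Lemma ln_ge_half (x : R) : 2 <= x -> 2^-1 <= ln x.
Proof.
move=> x2; rewrite -ler_expR lnK ?posrE; last lra.
(* [expR (1/2) <= 2] follows from [expR (- 1/2) >= 1 - 1/2]. *)
apply: le_trans _ x2; rewrite -[leLHS]invrK -expRN invf_ple ?posrE ?expR_gt0//.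
by apply: le_trans (expR_ge1Dx _); lra.
Qed.

(** This lets rounding up cost at most a factor 2. The maximum is at least 4 because
    [tbar - b < 1/2], and the logarithm is at least 1/2. *)
Lemma num_samples_ge1 (a delta : R) : 0 < eps < 2^-1 -> b < tbar < 2^-1 ->
  0 < delta < 1 -> 1 <= num_samples adv eps tbar B m2bar a delta.
Proof.
move=> /bias_gt0 b0 /andP[bt t2] /andP[d0 d1].
have M4 : 4 <= maxterm a.
  rewrite /maxterm le_max; apply/orP; right.
  rewrite -[leLHS]invrK lef_pV2 ?posrE ?exprn_gt0 ?subr_gt0 ?invr_gt0//.
  rewrite (_ : 4^-1 = 2^-1 ^+ 2 :> R); last by field.
  by rewrite ler_pXn2r// ?nnegrE; lra.
have L2 : 2^-1 <= logterm delta.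
  by apply: ln_ge_half; rewrite ler_pdivlMr//; case: adv; lra.
rewrite /num_samples -/(maxterm a) -/(logterm delta).
have : 4 * 2^-1 <= maxterm a * logterm delta by apply: ler_pM => //; lra.
by rewrite -mulrA; lra.
Qed.

Lemma natr_absz_ceil (x : R) : 0 <= x -> `|Num.ceil x|%N%:R = (Num.ceil x)%:~R :> R.
Proof. by move=> x0; rewrite natr_absz ger0_norm// ceil_ge0 (lt_le_trans _ x0). Qed.

(* [s] is the deviation of the cdf that n samples are able to detect. *)
Lemma num_samples_deviation (a delta : R) : 0 < eps < 2^-1 -> b < tbar < 2^-1 ->
  0 < B -> 0 <= m2bar -> 0 < a ->  0 < delta < 1 ->
  exists s : R, [/\ 0 < s, s < 1, b + s <= tbar, B * m2bar * s <= a &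
    forall n, num_samples adv eps tbar B m2bar a delta <= n ->
      expR (- (s ^+ 2 / 2 * n)) <= delta / (if adv is Malicious then 3 else 2)].
Proof.
move=> /bias_gt0 b0 /andP[bt t2] B0 m0 a0 /andP[d0 d1].
(* The first term of the maximum yields [B * m2bar * s <= a], the second [s <= tbar - b]. *)
pose M := maxterm a; pose s := (Num.sqrt M)^-1.
have Mt : (tbar - b) ^- 2 <= M by rewrite /M /maxterm le_max lexx orbT.
have Ma : B ^+ 2 * m2bar ^+ 2 / a ^+ 2 <= M by rewrite /M /maxterm le_max lexx.
have tb0 : 0 < tbar - b by rewrite subr_gt0.
have M0 : 0 < M by apply: lt_le_trans Mt; rewrite invr_gt0 exprn_gt0.
have s0 : 0 < s by rewrite invr_gt0 sqrtr_gt0.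
have s2 : s ^+ 2 = M^-1 by rewrite /s exprVn sqr_sqrtr// ltW.
have st : s <= tbar - b.
  rewrite -(@ler_pXn2r _ 2)// ?nnegrE ?(ltW s0) ?(ltW tb0)// s2.
  by rewrite -[leRHS]invrK lef_pV2 ?posrE// invr_gt0 exprn_gt0.
exists s; split; [by []|lra|lra| |].
  rewrite -(@ler_pXn2r _ 2)// ?nnegrE ?mulr_ge0 ?(ltW s0) ?(ltW a0) ?(ltW B0)//.
  rewrite !exprMn s2.
  by rewrite ler_pdivrMr// [leRHS]mulrC -ler_pdivrMr ?exprn_gt0.
move=> n; rewrite /num_samples -/(maxterm a) -/M => nn.
rewrite -[delta / _]lnK ?posrE; last by rewrite divr_gt0//; case: adv.
rewrite ler_expR -[leRHS]opprK lerN2 -lnV ?posrE; last by rewrite divr_gt0//; case: adv.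
rewrite invf_div -/(logterm delta) s2.
rewrite (_ : _ / 2 * n = (2 * M)^-1 * n); last by field; lra.
by rewrite mulrC ler_pdivlMr ?mulr_gt0// mulrC; exact: nn.
Qed.

(** For [alpha <= 1] the term free of [alpha] only grows when divided by [alpha ^+ 2], and the
    maximum is at most the sum. As [k / delta >= 2], the constants 2 and 3 in the logarithm are
    absorbed by [(k / delta) ^+ 2], whence three times [ln (k / delta)]. *)
Lemma num_samples_le (k alpha delta : R) :
  0 < alpha <= 1 -> 0 < delta < 1 -> 2 <= k ->
  num_samples adv eps tbar B m2bar (alpha / 2) (delta / k) <=
  6 * (4 * (B ^+ 2 * m2bar ^+ 2) + (tbar - b) ^- 2) / alpha ^+ 2 * ln (k / delta).
Proof.
move=> /andP[a0 a1] /andP[d0 d1] k2.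
set Q := B ^+ 2 * m2bar ^+ 2; set t := (tbar - b) ^- 2.
have Q0 : 0 <= Q by rewrite mulr_ge0 ?sqr_ge0.
have t0 : 0 <= t by rewrite invr_ge0 sqr_ge0.
have x2 : 2 <= k / delta by rewrite ler_pdivlMr//; nra.
have a20 : 0 < alpha ^+ 2 by rewrite exprn_gt0.
have a21 : 1 <= (alpha ^+ 2)^-1 by rewrite invf_ge1// expr_le1// ltW.
have Mle : maxterm (alpha / 2) <= (4 * Q + t) / alpha ^+ 2.
  rewrite /maxterm -/Q -/t ge_max mulrDl; apply/andP; split.
    rewrite (_ : Q / _ = 4 * Q / alpha ^+ 2); last by field; lra.
    by rewrite lerDl mulr_ge0// ?invr_ge0 ?(ltW a20).
  apply: (@le_trans _ _ (t / alpha ^+ 2)); first by rewrite ler_peMr.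
  by rewrite lerDr mulr_ge0// ?invr_ge0 ?(ltW a20)// mulr_ge0.
have Lle : logterm (delta / k) <= 3 * ln (k / delta).
  rewrite mulr_natl -lnXn; last lra.
  rewrite /logterm ler_ln ?posrE; first last.
  - by rewrite exprn_gt0; lra.
  - by rewrite divr_gt0 ?divr_gt0//; [case: adv|lra].
  rewrite invf_div exprSr ler_wpM2r//; first lra.
  rewrite (le_trans (y := 2 ^+ 2))//; first by case: adv; lra.
  by rewrite ler_pXn2r// ?nnegrE; lra.
have L0 : 0 <= logterm (delta / k).
  rewrite (le_trans _ (ln_ge_half _))// invf_div.
  by case: adv; nra.
rewrite /num_samples -/(maxterm _) -/(logterm _) -[leLHS]mulrA.
have : maxterm (alpha / 2) * logterm (delta / k) <=
    (4 * Q + t) / alpha ^+ 2 * (3 * ln (k / delta)).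
  by apply: ler_pM => //; rewrite /maxterm le_max invr_ge0 sqr_ge0 orbT.
rewrite -/t -/Q; set X := (_ + t) / _.
rewrite (_ : 6 * _ / _ = 6 * X); last by rewrite /X mulrA.
lra.
Qed.

End SampleSize.

(** * Correctness and cost of the median algorithm *)

Section MedianAlgorithmPAC.
Context {R : realType} {k : nat}.
Variables (adv : adversary) (eps tbar B m2bar : R).

Lemma median_algorithm_PAC (N : nat) (alpha delta : R) (alg : algorithm R k) :
  0 < eps < 2^-1 -> bias adv eps < tbar < 2^-1 -> 0 < B ->
  (0 < k)%N -> 0 < alpha -> 0 < delta < 1 ->
  num_samples adv eps tbar B m2bar (alpha / 2) (delta / k%:R) <= N%:R ->
  median_algorithm N alg -> PAC adv eps tbar B m2bar alpha delta alg.
Proof.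
move=> epsP tP B0 k0 a0 /andP[d0 d1] nN [sched schedN algP].
move=> d Omega P F Y D Z Ffam m2F inst istar best.
have b0 := bias_gt0 adv epsP; have /andP[bt t2] := tP.
have t0 : 0 < tbar < 2^-1 by rewrite t2 andbT; lra.
have k1 : (1 : R) <= k%:R by rewrite ler1n.
have kgt0 : (0 : R) < k%:R by lra.
have m2bar0 : 0 <= m2bar by exact: le_trans (m2_ge0 _) (m2F istar).
have dk : 0 < delta / k%:R < 1.
  by rewrite divr_gt0//= ltr_pdivrMr// mul1r; lra.
have a20 : 0 < alpha / 2 by lra.
have [s [s0 s1 bst Bs expN]] := num_samples_deviation epsP tP B0 m2bar0 a20 dk.
have BsF i : B * m2 (F i) * s <= alpha / 2.
  by apply: le_trans Bs; rewrite ler_wpM2r ?(ltW s0)// ler_wpM2l ?(ltW B0).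
(* The iterations at which arm [i] is sampled, fixed in advance. *)
pose J i := [seq t <- iota 0 (k * N) | sched t == i].
have szJ i : size (J i) = N by rewrite size_filter.
have uJ i : uniq (J i) by rewrite filter_uniq// iota_uniq.
pose r i := uncertainty adv eps B (F i) + alpha / 2.
pose hi i := m1 (F i) + r i; pose lo i := m1 (F i) - r i.
pose bad i := conceded_majority (Y := Y) (D := D) `]hi i, +oo[ i (J i) `|`
              conceded_majority (Y := Y) (D := D) `]-oo, lo i[ i (J i).
have mbad i : measurable (bad i).
  by apply: measurableU; apply: measurable_conceded_majority.
have Pbad i : (P (bad i) <= (delta / k%:R)%:E)%E.
  have s01 : 0 < s < 1 by rewrite s0.
  have Fhi : (F i `]hi i, +oo[%classic <= (2^-1 - (bias adv eps + s))%:E)%E.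
    rewrite -setCitvl probability_setC// -cdf_ofE -EFinB lee_fin.
    have := in_family_cdf_of_ge t0 B0 (Ffam i) (ltW b0) s0 bst a20 (BsF i).
    by rewrite /hi /r /uncertainty; lra.
  have Flo : (F i `]-oo, lo i[%classic <= (2^-1 - (bias adv eps + s))%:E)%E.
    apply: (@le_trans _ _ (F i `]-oo, lo i]%classic)).
      by apply: le_measure; rewrite ?inE//; apply: subset_itvl; rewrite bnd_simp.
    rewrite -cdf_ofE lee_fin.
    exact: in_family_cdf_of_le t0 B0 (Ffam i) (ltW b0) s0 bst a20 (BsF i).
  apply: le_trans (measureU2 _ _ _) _.
  - exact: measurable_conceded_majority.
  - exact: measurable_conceded_majority.
  have Phi := prob_conceded_majority_le epsP s01 inst (measurable_itv _) Fhi (uJ i).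
  have Plo := prob_conceded_majority_le epsP s01 inst (measurable_itv _) Flo (uJ i).
  apply: le_trans (leeD Phi Plo) _; rewrite szJ -EFinD lee_fin.
  have /andP[dk0 _] := dk.
  (* Each ray costs at most [delta / k] divided by 2 or 3, so both together at most [delta / k]. *)
  have := expN _ nN; case: (adv); lra.
pose good := ~` \big[setU/set0]_(i < k) bad i.
have mU : measurable (\big[setU/set0]_(i < k) bad i) by exact: bigsetU_measurable.
have Pgood : ((1 - delta)%:E <= P good)%E.
  rewrite /good probability_setC// EFinB leeB//.
  exact: prob_bigcup_ord_le mbad Pbad k0.
apply: le_trans Pgood _.
(* On the good event the conclusion holds for every seed. *)
apply: product_measure1_ge_setX; first exact: measurableC.
move=> w v goodw; exists (k * N)%N => /=.
set x := fun i t => contaminated Y D Z i t w.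
have pullE (s' : seed alg) (h : seq R) :
    (size h < k * N)%N -> pull s' h = sched (size h).
  by have [] := algP s' h.
have stopE (s' : seed alg) (h : seq R) :
    (size h <= k * N)%N -> stop s' h = (size h == k * N)%N.
  by have [] := algP s' h.
split; first exact: (stops_at_mulkN pullE stopE).
set h := history _ _ _; set I := output v h.
have med i : lo i <= empirical_median (arm_samples sched h i) <= hi i.
  rewrite (arm_samples_history pullE).
  apply: empirical_median_bounds => badw; apply: goodw;
    rewrite (bigD1 i)//=; left; [by left|by right].
have szh : size h = (k * N)%N by rewrite /h (history_mkseq pullE)// size_mkseq.
have [_ _ /(_ szh istar)] := algP v h; rewrite -/I => leI.
(* Chain [lo istar], the median of [istar], that of [I], and [hi I]; the two margins [alpha / 2] add
   up to [alpha]. *)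
have /andP[+ _] := med istar; have /andP[_ +] := med I.
rewrite /effective_gap /lo /hi /r; lra.
Qed.

End MedianAlgorithmPAC.

Lemma median_algorithm_sample_complexity {R : realType} (k N : nat)
    (alg : algorithm R k) (M : R) :
  median_algorithm N alg -> k%:R * N%:R <= M -> sample_complexity_le alg M.
Proof.
move=> [sched _ algP] kNM s x; exists (k * N)%N; last by rewrite natrM.
by apply: (@stops_at_mulkN _ _ _ _ sched) => s' h; have [] := algP s' h.
Qed.

Theorem theorem14 (R : realType) :
  exists C0 : R, forall (adv : adversary) (eps tbar B m2bar : R),
  0 < eps < 2^-1 -> bias adv eps < tbar < 2^-1 -> 0 < B ->
  let n (k : nat) (alpha delta : R) : R :=
    num_samples adv eps tbar B m2bar (alpha / 2) (delta / k%:R) in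
  let N (k : nat) (alpha delta : R) : nat :=
    `|Num.ceil (n k alpha delta)|%N in
  (forall (k : nat) (alpha delta : R) (alg : algorithm R k),
     (1 < k)%N -> 0 < alpha -> 0 < delta < 1 ->
     median_algorithm (N k alpha delta) alg ->
     PAC adv eps tbar B m2bar alpha delta alg /\
     sample_complexity_le alg (C0 * (k%:R * n k alpha delta))) /\
  (exists C alpha0 : R, 0 < alpha0 /\
     forall (k : nat) (alpha delta : R) (alg : algorithm R k),
       (1 < k)%N -> 0 < alpha <= alpha0 -> 0 < delta < 1 ->
       median_algorithm (N k alpha delta) alg ->
       sample_complexity_le alg
         (C * (k%:R / alpha ^+ 2 * ln (k%:R / delta)))).
Proof.
(* Since [n >= 1], rounding up gives at most [n + 1 <= 2 * n]. *)
exists 2 => adv eps tbar B m2bar epsP tP B0 n N.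
have n1 k alpha delta : (1 < k)%N -> 0 < delta < 1 -> 1 <= n k alpha delta.
  move=> k1 /andP[d0 d1]; apply: num_samples_ge1 => //.
  have kR : 1 < k%:R :> R by rewrite ltr1n.
  by rewrite divr_gt0 ?ltr_pdivrMr//=; lra.
have N_le k alpha delta : (1 < k)%N -> 0 < delta < 1 ->
    k%:R * (N k alpha delta)%:R <= k%:R * (2 * n k alpha delta).
  move=> k1 dP; have n1' := n1 k alpha delta k1 dP.
  rewrite ler_wpM2l// natr_absz_ceil; last lra.
  by have := ceilB1_lt (n k alpha delta); rewrite intrB; lra.
split.
  move=> k alpha delta alg k1 a0 dP medalg; split.
    apply: median_algorithm_PAC medalg => //; first exact: ltnW.
    rewrite natr_absz_ceil; first exact: ceil_ge.
    exact: le_trans ler01 (n1 _ _ _ k1 dP).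
  apply: median_algorithm_sample_complexity medalg _.
  by rewrite mulrCA; exact: N_le.
(* The 12 is the 6 of [num_samples_le] times the 2 from rounding; that bound requires
   [alpha <= 1]. *)
exists (12 * (4 * (B ^+ 2 * m2bar ^+ 2) + (tbar - bias adv eps) ^- 2)), 1.
split=> // k alpha delta alg k1 aP dP medalg.
apply: median_algorithm_sample_complexity medalg _.
apply: le_trans (N_le _ _ _ k1 dP) _.
have k2 : 2 <= k%:R :> R by rewrite ler_nat.
have := num_samples_le adv eps tbar B m2bar aP dP k2.
rewrite -/(n k alpha delta) => nle.
have := ler_wpM2l (ler0n R k) (ler_wpM2l (ler0n R 2) nle).
move=> /le_trans; apply; rewrite le_eqVlt; apply/orP; left; apply/eqP.
set X := 4 * _ + _; set l := ln _.
by field; have /andP[? _] := aP; lra.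
Qed.
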